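(* Let $a\in\mathbb{Q}^\times$, $\lambda=-2a^2$, and let $E$ be the elliptic curve $y^2=x(x-1)(x-\lambda)$. Put $$D(\lambda,u)=\lambda(2\lambda-1)u^2+2-\lambda,$$ $$N(\lambda,u)=\lambda^2(\lambda+1)(2\lambda-1)^2u^4-4\lambda^2(\lambda-1)(2\lambda-1)u^3+2\lambda(\lambda+1)(2\lambda^2-3\lambda+2)u^2-4\lambda(\lambda-1)(\lambda-2)u+(\lambda-2)^2(\lambda+1),$$ and let $g(u)$ be the polynomial of degree $12$ $$g(u)=2N(\lambda,u)\bigl(N(\lambda,u)-2D(\lambda,u)^2\bigr)\bigl(N(\lambda,u)-2\lambda D(\lambda,u)^2\bigr).$$ Then $E_{g(u)}$ has rank at least $3$ over $\mathbb{Q}(u)$, with independent points $$P_1=\Bigl(\frac{N(\lambda,u)}{2D(\lambda,u)^2},\ \frac{1}{4D(\lambda,u)^3}\Bigr),$$ $$P_2=\Bigl(\frac{\lambda^2\bigl(D(\lambda,u)^2-4\lambda u(u-1)(\lambda(2\lambda-1)u+2-\lambda)\bigr)}{(\lambda(2\lambda-1)u^2-2\lambda(2\lambda-1)u+\lambda-2)^2},\ \frac{a\lambda}{(\lambda(2\lambda-1)u^2-2\lambda(2\lambda-1)u+\lambda-2)^3}\Bigr),$$ $$P_3=\Bigl(\frac{D(\lambda,u)^2+4\lambda u(u-1)(\lambda(2\lambda-1)u+2-\lambda)}{\lambda(\lambda(2\lambda-1)u^2-(2\lambda-4)u+\lambda-2)^2},\ -\frac{a}{\lambda^2(\lambda(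2\lambda-1)u^2-(2\lambda-4)u+\lambda-2)^3}\Bigr).$$
   Context: For $D\in\mathbb{Q}(u)^\times$, $E_D$ denotes the quadratic twist $Dy^2=x(x-1)(x-\lambda)$ over $\mathbb{Q}(u)$. *)

(* Defs.v *)
From HB Require Import structures.
From mathcomp Require Import all_boot all_order all_algebra.
From mathcomp Require Import ring.

Set Implicit Arguments.
Unset Strict Implicit.
Unset Printing Implicit Defensive.

Import Order.TTheory GRing.Theory Num.Theory.
Local Open Scope ring_scope.

Inductive point (K : Type) := Infinity | Affine of K & K.
Arguments Infinity {K}.

Section LegendreTwist.

(* The twist [d y^2 = x (x - 1) (x - lam)] of the Legendre curve; it is an
   elliptic curve when 2, d, lam and lam - 1 are nonzero in K. *)
Variables (K : fieldType) (lam d : K).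

Definition on_twist (P : point K) : Prop :=
  if P is Affine x y then d * y ^+ 2 = x * (x - 1) * (x - lam) else True.

Definition twist_opp (P : point K) : point K :=
  if P is Affine x y then Affine x (- y) else Infinity.

(* Slope of the chord, or of the tangent line if x1 = x2; the latter comes from
   2 d y y' = 3 x^2 - 2 (1 + lam) x + lam. *)
Definition twist_slope (x1 y1 x2 y2 : K) : K :=
  if x1 == x2 then (3 * x1 ^+ 2 - 2 * (1 + lam) * x1 + lam) / (2 * d * y1)
  else (y2 - y1) / (x2 - x1).

Definition twist_add (P Q : point K) : point K :=
  match P, Q with
  | Infinity, _ => Q
  | _, Infinity => P
  | Affine x1 y1, Affine x2 y2 =>
      if (x1 == x2) && (y1 == - y2) then Infinity
      else
        let m := twist_slope x1 y1 x2 y2 in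
        let x3 := d * m ^+ 2 + 1 + lam - x1 - x2 in
        Affine x3 (m * (x1 - x3) - y1)
  end.

Definition twist_muln (P : point K) (n : nat) : point K :=
  iter n (twist_add P) Infinity.

Definition twist_mulz (P : point K) (n : int) : point K :=
  match n with
  | Posz m => twist_muln P m
  | Negz m => twist_opp (twist_muln P m.+1)
  end.

(* The sum below is iterated chord-and-tangent addition, associated to the
   right; no monoid structure is declared on points. *)
Definition twist_independent (r : nat) (P : r.-tuple (point K)) : Prop :=
  (forall i, on_twist (tnth P i)) /\
  forall n : 'I_r -> int,
    \big[twist_add/Infinity]_(i < r) twist_mulz (tnth P i) (n i) = Infinity ->
    forall i, n i = 0.

Definition twist_rank_ge (r : nat) : Prop :=
  exists P : r.-tuple (point K), twist_independent P.

Lemma on_twist_opp P : on_twist P -> on_twist (twist_opp P).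
Proof. by case: P => //= x y; rewrite sqrrN. Qed.

Lemma on_twist_add P Q :
  2 != 0 :> K -> d != 0 -> on_twist P -> on_twist Q -> on_twist (twist_add P Q).
Proof.
move=> two0 d0; case: P => [|x1 y1]; case: Q => [|x2 y2] //= h1 h2.
case: ifP => //= /negbT; rewrite negb_and /twist_slope.
case: eqVneq => [e | ne _]; last first.
  have ne0 : x2 - x1 != 0 by rewrite subr_eq0 eq_sym.
  set m := (y2 - y1) / _.
  have e2 : y2 = y1 + m * (x2 - x1) by rewrite /m divfK // addrC subrK.
  move: h2; rewrite e2 => h2; apply: (mulfI ne0).
  set x3 := _ - _ - _.
  have h : (x2 - x1) * (d * (m * (x1 - x3) - y1) ^+ 2 - x3 * (x3 - 1) * (x3 - lam))
    = (x3 - x1) * (d * (y1 + m * (x2 - x1)) ^+ 2 - x2 * (x2 - 1) * (x2 - lam))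
    - (x3 - x2) * (d * y1 ^+ 2 - x1 * (x1 - 1) * (x1 - lam)) by rewrite /x3; ring.
  apply/eqP; rewrite -subr_eq0 -mulrBr h h1 h2 !subrr !mulr0 subrr; exact: eqxx.
subst x2 => /= ne.
have : (y1 - y2) * (y1 + y2) = 0.
  apply: (mulfI d0); rewrite mulr0 -subr_sqr mulrBr h1 h2; ring.
move/eqP; rewrite mulf_eq0 [y1 + y2 == 0]addr_eq0 (negPf ne) orbF subr_eq0.
move/eqP=> e; subst y2.
have y0 : y1 != 0.
  by apply: contra_neq ne => ->; rewrite oppr0.
have ne0 : 2 * d * y1 != 0 by rewrite !mulf_neq0.
set m := _ / (2 * d * y1).
have e2 : 2 * d * y1 * m = 3 * x1 ^+ 2 - 2 * (1 + lam) * x1 + lam.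
  by rewrite /m mulrC divfK.
set x3 := _ - _ - _.
have h : d * (m * (x1 - x3) - y1) ^+ 2 - x3 * (x3 - 1) * (x3 - lam)
  = (d * y1 ^+ 2 - x1 * (x1 - 1) * (x1 - lam))
  + (x3 - x1) * (2 * d * y1 * m
      - (3 * x1 ^+ 2 - 2 * (1 + lam) * x1 + lam)) by rewrite /x3; ring.
by apply/eqP; rewrite -subr_eq0 h h1 e2 !subrr mulr0 addr0.
Qed.

End LegendreTwist.

Notation ratfun := {fraction {poly rat}}.

Definition ratc (c : rat) : ratfun := tofrac c%:P.
Definition uvar : ratfun := tofrac 'X.

Section Family.

Variables a lam : rat.
Local Notation L := (lam%:P : {poly rat}).
Local Notation U := ('X : {poly rat}).

Definition polyD : {poly rat} := L * (2 * L - 1) * U ^+ 2 + 2 - L.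

Definition polyN : {poly rat} :=
  L ^+ 2 * (L + 1) * (2 * L - 1) ^+ 2 * U ^+ 4
  - 4 * L ^+ 2 * (L - 1) * (2 * L - 1) * U ^+ 3
  + 2 * L * (L + 1) * (2 * L ^+ 2 - 3 * L + 2) * U ^+ 2
  - 4 * L * (L - 1) * (L - 2) * U
  + (L - 2) ^+ 2 * (L + 1).

Definition polyg : {poly rat} :=
  2 * polyN * (polyN - 2 * polyD ^+ 2) * (polyN - 2 * L * polyD ^+ 2).

Local Notation A := (ratc a).
Local Notation l := (ratc lam).
Local Notation u := uvar.
Local Notation D := (tofrac polyD).
Local Notation N := (tofrac polyN).

Definition P1 : point ratfun := Affine (N / (2 * D ^+ 2)) (1 / (4 * D ^+ 3)).

Definition P2 : point ratfun :=
  let q := l * (2 * l - 1) * u ^+ 2 - 2 * l * (2 * l - 1) * u + l - 2 in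
  Affine
    (l ^+ 2 * (D ^+ 2 - 4 * l * u * (u - 1) * (l * (2 * l - 1) * u + 2 - l))
       / q ^+ 2)
    (A * l / q ^+ 3).

Definition P3 : point ratfun :=
  let q := l * (2 * l - 1) * u ^+ 2 - (2 * l - 4) * u + l - 2 in
  Affine
    ((D ^+ 2 + 4 * l * u * (u - 1) * (l * (2 * l - 1) * u + 2 - l))
       / (l * q ^+ 2))
    (- (A / (l ^+ 2 * q ^+ 3))).

End Family.

(* Main.v *)
(* On E_g over Q(u), with equation g y^2 = f(x), the map (x, y) |-> x'/y is, up
   to the factor 1/sqrt(g), the pull-back of the invariant differential of E, so
   it is additive: a relation between P1, P2, P3 gives a Q-linear relation between
   the functions x'/y. Each Pi has the form (c p/q^2, e/q^3) with constants c, e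
   and polynomials p, q, so x'/y is (c/e) Vi with Vi = p' q - 2 p q'. Only V1 has
   a term in u^2, and the matrix of the coefficients of 1 and u^3 in V2, V3 has
   determinant lam^2 - lam + 1 up to factors vanishing only at 0, 1, 2, 1/2. *)
Require Import Defs.
From HB Require Import structures.
From mathcomp Require Import all_boot all_order all_algebra.
From mathcomp Require Import generic_quotient ring lra.
Import Order.TTheory GRing.Theory Num.Theory.
Local Open Scope ring_scope.

Set Implicit Arguments.
Unset Strict Implicit.

(** * Derivations of a field and additivity of x'/y on a twist *)

Section Derivation.

Variables (K : fieldType) (del : K -> K).
Hypothesis delD : forall x y, del (x + y) = del x + del y.
Hypothesis delM : forall x y, del (x * y) = del x * y + x * del y.

Lemma derivation0 : del 0 = 0.
Proof. by apply: (addrI (del 0)); rewrite -delD !addr0. Qed.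

Lemma derivation1 : del 1 = 0.
Proof. by apply: (addrI (del 1)); rewrite -{3}[1]mulr1 delM mulr1 mul1r addr0. Qed.

Lemma derivationN x : del (- x) = - del x.
Proof. by apply/eqP; rewrite -addr_eq0 -delD addNr derivation0. Qed.

Lemma derivationB x y : del (x - y) = del x - del y.
Proof. by rewrite delD derivationN. Qed.

Lemma derivation_nat n : del n%:R = 0.
Proof.
elim: n => [|n IHn]; first exact: derivation0.
by rewrite mulrS delD derivation1 IHn addr0.
Qed.

Lemma derivationX2 x : del (x ^+ 2) = 2 * x * del x.
Proof. by rewrite expr2 delM; ring. Qed.

Lemma derivation_div x y : y != 0 -> del (x / y) = (del x - x / y * del y) / y.
Proof.
move=> y0; apply: (mulIf y0); rewrite divfK //.
by rewrite -{2}(divfK y0 x) (delM (x / y)) addrK.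
Qed.

Variables lam d : K.
Hypothesis (two0 : 2 != 0 :> K) (d0 : d != 0).
Hypothesis (lam0 : lam != 0) (lam1 : lam != 1) (del_lam : del lam = 0).

(* [diff_value P w] says that w is x'/y at P. The second equation is the
   derivative of the curve equation divided by y; together with the division-free
   form of the first it keeps the relation additive where y = 0. *)
Definition diff_value (P : point K) (w : K) : Prop :=
  if P is Affine x y then
    del x = w * y /\
    2 * d * del y = (3 * x ^+ 2 - 2 * (1 + lam) * x + lam) * w - del d * y
  else w = 0.

Lemma diff_value_affine x y w :
  on_twist lam d (Affine x y) -> y != 0 -> del x = w * y ->
  diff_value (Affine x y) w.
Proof.
move=> /= h y0 ex; split=> //; apply: (mulIf y0).
have: del (d * y ^+ 2) = del (x * (x - 1) * (x - lam)) by rewrite h.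
rewrite !delM !derivationB derivation1 del_lam ex => e.
have -> : 2 * d * del y * y = del d * y ^+ 2 + d * (del y * y + y * del y) - del d * y ^+ 2
  by ring.
by rewrite e; ring.
Qed.

Lemma diff_value_opp P w :
  diff_value P w -> diff_value (twist_opp P) (- w).
Proof.
case: P => [|x y] /=; first by move=> ->; rewrite oppr0.
by case=> ex ey; rewrite !derivationN mulrNN ex mulrN ey; split=> //; ring.
Qed.

(** The roots 0, 1 and [lam] are distinct, so the derivative of the cubic is nonzero at each of
    them. This pins down [w] at points with y = 0, where del x = w y says nothing about it. *)
Lemma two_torsion_slope x :
  x * (x - 1) * (x - lam) = 0 -> 3 * x ^+ 2 - 2 * (1 + lam) * x + lam != 0.
Proof.
move/eqP; rewrite !mulf_eq0 !subr_eq0 => /orP[/orP[]|] /eqP ->.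
- by have -> : 3 * 0 ^+ 2 - 2 * (1 + lam) * 0 + lam = lam by ring.
- have -> : 3 * 1 ^+ 2 - 2 * (1 + lam) * 1 + lam = 1 - lam by ring.
  by rewrite subr_eq0 eq_sym.
- have -> : 3 * lam ^+ 2 - 2 * (1 + lam) * lam + lam = lam * (lam - 1) by ring.
  by rewrite mulf_neq0 // subr_eq0.
Qed.

(** Differentiating the chord relation y2 - y1 = m (x2 - x1) determines [del m]. After
    multiplication by x2 - x1, both equations for the sum contain [del m] only through 2 d (del m)
    (x2 - x1). What remains is a polynomial identity modulo the chord relation and the difference of
    the two curve equations. *)
Lemma chord_diff_value x1 y1 x2 y2 w1 w2 :
    on_twist lam d (Affine x1 y1) -> on_twist lam d (Affine x2 y2) ->
    diff_value (Affine x1 y1) w1 -> diff_value (Affine x2 y2) w2 -> x1 != x2 ->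
  let m := (y2 - y1) / (x2 - x1) in
  let x3 := d * m ^+ 2 + 1 + lam - x1 - x2 in
  diff_value (Affine x3 (m * (x1 - x3) - y1)) (w1 + w2).
Proof.
move=> /= c1 c2 [ex1 ey1] [ex2 ey2] ne.
have h0 : x2 - x1 != 0 by rewrite subr_eq0 eq_sym.
set m := _ / _; set x3 := _ - _ - _.
have ely : y2 - y1 = m * (x2 - x1) by rewrite /m divfK.
(* The chord condition solves for lam once 1 + lam is treated as a separate
   unknown, which is how it is substituted below. *)
have elam : lam = d * m * (y1 + y2) - (x1 ^+ 2 + x1 * x2 + x2 ^+ 2)
    + (1 + lam) * (x1 + x2).
  apply: (mulIf h0); apply/eqP; rewrite -subr_eq0; apply/eqP.
  transitivity (d * (y1 + y2) * (y2 - y1 - m * (x2 - x1))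
    + (d * y1 ^+ 2 - x1 * (x1 - 1) * (x1 - lam))
    - (d * y2 ^+ 2 - x2 * (x2 - 1) * (x2 - lam))); first by ring.
  by rewrite c1 c2 ely !subrr; ring.
(* The factor 2 d is kept so that [ey1] and [ey2] can replace the derivatives of y1 and y2. *)
have eM : 2 * d * del m * (x2 - x1)
    = 2 * d * del y2 - 2 * d * del y1 - 2 * d * m * (w2 * y2 - w1 * y1).
  have := congr1 del ely; rewrite delM !derivationB ex1 ex2 => e.
  have -> : 2 * d * del m * (x2 - x1)
    = 2 * d * (del m * (x2 - x1) + m * (w2 * y2 - w1 * y1))
      - 2 * d * m * (w2 * y2 - w1 * y1) by ring.
  by rewrite -e; ring.
have ex3 : x3 = d * m ^+ 2 + (1 + lam) - x1 - x2 by rewrite /x3; ring.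
have dx3 : del x3 = del d * m ^+ 2 + 2 * d * m * del m - w1 * y1 - w2 * y2.
  rewrite /x3 !(derivationB, delD) delM derivationX2 derivation1 del_lam ex1 ex2.
  by ring.
have dy3 : del (m * (x1 - x3) - y1)
    = del m * (x1 - x3) + m * (w1 * y1 - del x3) - del y1.
  by rewrite !(derivationB, delM) ex1.
have ey : y2 = y1 + m * (x2 - x1) by rewrite -ely addrC subrK.
have X3 : del x3 = (w1 + w2) * (m * (x1 - x3) - y1).
  rewrite dx3; apply: (mulIf h0); apply/eqP; rewrite -subr_eq0; apply/eqP.
  transitivity (m * (2 * d * del m * (x2 - x1)) + (x2 - x1) *
     (del d * m ^+ 2 - w1 * y1 - w2 * y2 - (w1 + w2) * (m * (x1 - x3) - y1))).
    by ring.
  rewrite eM ey1 ey2 ex3; move: (1 + lam) elam => e ->; rewrite ey.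
  by ring.
split=> //; rewrite dy3 X3; apply: (mulIf h0); apply/eqP; rewrite -subr_eq0.
apply/eqP; transitivity ((x1 - x3) * (2 * d * del m * (x2 - x1)) + (x2 - x1) *
   (2 * d * m * (w1 * y1 - (w1 + w2) * (m * (x1 - x3) - y1)) - 2 * d * del y1
    - (3 * x3 ^+ 2 - 2 * (1 + lam) * x3 + lam) * (w1 + w2)
    + del d * (m * (x1 - x3) - y1))).
  by ring.
rewrite eM ey1 ey2 ex3; move: (1 + lam) elam => e ->; rewrite ey.
by ring.
Qed.

(** Same scheme as for the chord: the slope equation [em] is differentiated in place of the chord
    relation, and the factor to cancel is y. *)
Lemma tangent_diff_value x y w :
    diff_value (Affine x y) w -> y != 0 ->
  let m := (3 * x ^+ 2 - 2 * (1 + lam) * x + lam) / (2 * d * y) in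
  let x3 := d * m ^+ 2 + 1 + lam - x - x in
  diff_value (Affine x3 (m * (x - x3) - y)) (w + w).
Proof.
move=> [ex ey] y0 /=.
have h0 : 2 * d * y != 0 by rewrite !mulf_neq0.
set m := _ / (2 * d * y).
have em : 3 * x ^+ 2 - 2 * (1 + lam) * x + lam = 2 * d * y * m.
  by rewrite [RHS]mulrC divfK.
(* From here on [m] is known only through [em], so that no quotient reaches [ring]. *)
move: (m) em => {}m em; set x3 := _ - _ - _.
have eM : 2 * d * del m = (6 * x - 2 * (1 + lam)) * w - del d * m - 2 * d * m ^+ 2 * w.
  apply: (mulIf y0); have := congr1 del em.
  rewrite !(derivationB, delD, delM, derivationX2, derivation_nat, derivation1) del_lam ex.
  (* The term 0 * d, left by the derivative of 2, stays so that the first three summands match the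
     right side of [e]. *)
  move=> e; transitivity ((0 * d + 2 * del d) * y * m + 2 * d * del y * m
    + 2 * d * y * del m - 2 * del d * y * m - 2 * d * del y * m); first by ring.
  by rewrite -mulrDl -e ey em; ring.
have ex3 : x3 = d * m ^+ 2 + (1 + lam) - x - x by rewrite /x3; ring.
have dx3 : del x3 = del d * m ^+ 2 + 2 * d * m * del m - w * y - w * y.
  rewrite /x3 !(derivationB, delD) delM derivationX2 derivation1 del_lam ex.
  by ring.
have dy3 : del (m * (x - x3) - y)
    = del m * (x - x3) + m * (w * y - del x3) - del y.
  by rewrite !(derivationB, delM) ex.
have X3 : del x3 = (w + w) * (m * (x - x3) - y).
  rewrite dx3.
  have -> : 2 * d * m * del m = m * (2 * d * del m) by ring.
  by rewrite eM ex3; ring.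
split=> //; rewrite dy3 X3.
transitivity (2 * d * del m * (x - x3)
  + 2 * d * m * (w * y - (w + w) * (m * (x - x3) - y)) - 2 * d * del y).
  by ring.
have elam : lam = 2 * d * y * m - 3 * x ^+ 2 + 2 * (1 + lam) * x.
  by rewrite -em; ring.
by rewrite ey em eM ex3; move: (1 + lam) elam => e ->; ring.
Qed.

Lemma diff_value_add P Q w1 w2 :
    on_twist lam d P -> on_twist lam d Q -> diff_value P w1 -> diff_value Q w2 ->
  diff_value (twist_add lam d P Q) (w1 + w2).
Proof.
case: P => [|x1 y1]; first by move=> _ _ -> ; rewrite add0r.
case: Q => [|x2 y2]; first by move=> _ _ + ->; rewrite addr0.
move=> c1 c2 v1 v2; rewrite /twist_add /twist_slope.
case: eqVneq => [ex | ne]; last exact: chord_diff_value.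
subst x2; case: eqVneq => [ey | ne] /=.
  (* Here Q = -P and the sum is [Infinity], so w1 + w2 must vanish. This follows from the equations
     for [del x] if y2 is nonzero, and otherwise from those for [del y] with [two_torsion_slope]. *)
  case: v1 v2 c1 => ex1 ey1 [ex2 ey2] /= c1.
  have [y0 | y0] := eqVneq y2 0; last first.
    by apply: (mulIf y0); rewrite mul0r mulrDl -ex2 ex1 ey; ring.
  move: ey1 ey2 c1; rewrite ey y0 oppr0 derivation0 expr0n /= !mulr0 !subr0 => e1 e2.
  move/esym/two_torsion_slope => s0.
  by apply: (mulfI s0); rewrite mulrDr -e1 -e2 addr0 mulr0.
(* Equal abscissas give y1^2 = y2^2, and y1 = - y2 is excluded. *)
have ey : y1 = y2.
  apply/eqP; rewrite -subr_eq0 -(mulIr_eq0 _ (mulIf (x := y1 + y2) _)) ?addr_eq0 //.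
  rewrite -subr_sqr subr_eq0; apply/eqP; apply: (mulfI d0).
  by rewrite c1 c2.
subst y2.
have y0 : y1 != 0 by apply: contra_neq ne => ->; rewrite oppr0.
have -> : w2 = w1 by apply: (mulIf y0); case: v1 v2 => <- _ [<- _].
exact: tangent_diff_value.
Qed.

Lemma diff_value_muln P w n :
  on_twist lam d P -> diff_value P w ->
  on_twist lam d (twist_muln lam d P n) /\
  diff_value (twist_muln lam d P n) (w *+ n).
Proof.
move=> cP vP; elim: n => [|n [cn vn]] //=.
by split; [exact: on_twist_add | rewrite mulrS; exact: diff_value_add].
Qed.

Lemma diff_value_mulz P w n :
  on_twist lam d P -> diff_value P w ->
  on_twist lam d (twist_mulz lam d P n) /\
  diff_value (twist_mulz lam d P n) (w *~ n).
Proof.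
move=> cP vP; case: n => n; first exact: diff_value_muln.
have [cn vn] := diff_value_muln n.+1 cP vP.
by split; [exact: on_twist_opp | exact: diff_value_opp].
Qed.

(** The value at [Infinity] is 0, so a relation between the points becomes the same relation between
    the [w i]. Additivity is followed through the iterated sum itself, without associativity of the
    addition of points. *)
Lemma diff_value_independent r (P : r.-tuple (point K)) (w : 'I_r -> K) :
    (forall i, on_twist lam d (tnth P i)) ->
    (forall i, diff_value (tnth P i) (w i)) ->
    (forall n : 'I_r -> int, \sum_(i < r) w i *~ n i = 0 -> forall i, n i = 0) ->
  twist_independent lam d P.
Proof.
move=> cP vP free; split=> // n e; apply: free.
suff [_] : on_twist lam d
      (\big[twist_add lam d/Infinity]_(i < r) twist_mulz lam d (tnth P i) (n i)) /\
    diff_value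
      (\big[twist_add lam d/Infinity]_(i < r) twist_mulz lam d (tnth P i) (n i))
      (\sum_(i < r) w i *~ n i) by rewrite e.
apply: (big_ind2 (fun Q v => on_twist lam d Q /\ diff_value Q v)) => //.
- move=> Q v Q' v' [cQ vQ] [cQ' vQ'].
  by split; [exact: on_twist_add | exact: diff_value_add].
- by move=> i _; exact: diff_value_mulz.
Qed.

End Derivation.

(** * Extension of a derivation to a field of fractions by the quotient rule *)

Section QuotientDerivation.

Variables (R : idomainType) (K : fieldType) (iota : {rmorphism R -> K}).
Variables (num den : K -> R) (der : R -> R).
Hypothesis iota_inj : injective iota.
Hypothesis den_neq0 : forall x, den x != 0.
Hypothesis numden : forall x, x = iota (num x) / iota (den x).
Hypothesis derD : forall p q, der (p + q) = der p + der q.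
Hypothesis derM : forall p q, der (p * q) = der p * q + p * der q.

Definition quoderiv (x : K) : K :=
  iota (der (num x) * den x - num x * der (den x)) / iota (den x) ^+ 2.

Let iota_neq0 p : p != 0 -> iota p != 0.
Proof. by rewrite -(inj_eq iota_inj) rmorph0. Qed.

(** The choice of fraction does not matter: if p / q = n / d, differentiate p d = n q and eliminate.
    Sums and products can then be differentiated on any convenient representation. *)
Lemma quoderiv_div p q : q != 0 ->
  quoderiv (iota p / iota q) = iota (der p * q - p * der q) / iota q ^+ 2.
Proof.
move=> q0; rewrite /quoderiv; have := numden (iota p / iota q).
move: (num _) (den _) (den_neq0 (iota p / iota q)) => n d d0 e.
have e1 : p * d = n * q.
  apply: iota_inj; rewrite !rmorphM; apply/eqP.
  by rewrite -eqr_div ?iota_neq0 // e.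
have e2 : der p * d + p * der d = der n * q + n * der q.
  by rewrite -!derM e1.
apply/eqP; rewrite eqr_div ?expf_neq0 ?iota_neq0 // -!rmorphXn -!rmorphM.
apply/eqP; congr (iota _).
transitivity ((der n * q + n * der q) * q * d
  - (n * q) * (der q * d + q * der d)); first by ring.
by rewrite -e1 -e2; ring.
Qed.

Lemma quoderivD x y : quoderiv (x + y) = quoderiv x + quoderiv y.
Proof.
rewrite {1}(numden x) {1}(numden y) addf_div ?iota_neq0 //.
rewrite -!rmorphM -rmorphD quoderiv_div ?mulf_neq0 //.
rewrite /quoderiv !(derD, derM, rmorphB, rmorphD, rmorphM) /=.
by field; rewrite !iota_neq0.
Qed.

Lemma quoderivM x y : quoderiv (x * y) = quoderiv x * y + x * quoderiv y.
Proof.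
rewrite {1}(numden x) {1}(numden y) mulf_div.
rewrite -!rmorphM quoderiv_div ?mulf_neq0 //.
rewrite [X in _ = quoderiv x * X + _]numden [X in _ = _ + X * quoderiv y]numden.
rewrite /quoderiv !(derM, rmorphB, rmorphD, rmorphM) /=.
by field; rewrite !iota_neq0.
Qed.

Lemma quoderiv_embed p : quoderiv (iota p) = iota (der p).
Proof.
have der1 : der 1 = 0.
  by apply: (addrI (der 1)); rewrite -{3}[1]mulr1 derM mulr1 mul1r addr0.
have := quoderiv_div p (oner_neq0 _).
by rewrite rmorph1 expr1n !divr1 der1 mulr0 subr0 mulr1.
Qed.

End QuotientDerivation.

(** * Numerators and denominators in a fraction field *)

Section FractionField.

Variable R : idomainType.

Definition fracnum (x : {fraction R}) : R := (frac (repr x)).1.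
Definition fracden (x : {fraction R}) : R := (frac (repr x)).2.

Lemma fracden_neq0 x : fracden x != 0.
Proof. exact: denom_ratioP. Qed.

Lemma fracnumden x : x = tofrac (fracnum x) / tofrac (fracden x).
Proof.
have d0 : tofrac (fracden x) != 0 by rewrite tofrac_eq0 fracden_neq0.
apply: (mulIf d0); rewrite divfK //.
(* With both factors written as classes of ratios, the claim is an equivalence of explicit
   ratios. *)
rewrite -{1}[x]reprK; unlock FracField.tofrac.
apply: etrans (esym (FracField.pi_mul (repr x) (Ratio (fracden x) 1))) _.
apply/eqmodP; rewrite /= FracField.equivfE /mulf.
rewrite !numden_Ratio ?mulf_neq0 ?oner_eq0 ?denom_ratioP //.
by rewrite !mulr1 mulrC.
Qed.

Lemma tofrac_inj : injective (@tofrac R).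
Proof. by move=> p q /eqP; rewrite tofrac_eq => /eqP. Qed.

End FractionField.

(** The derivative of c p / q^2 has denominator q^3, which cancels against that of y = e / q^3. *)
Lemma diff_value_cube (K : fieldType) (del : K -> K) (lam d c e p q : K) :
    (forall x y, del (x + y) = del x + del y) ->
    (forall x y, del (x * y) = del x * y + x * del y) ->
    del lam = 0 -> del c = 0 -> e != 0 -> q != 0 ->
    on_twist lam d (Affine (c * p / q ^+ 2) (e / q ^+ 3)) ->
  diff_value del lam d (Affine (c * p / q ^+ 2) (e / q ^+ 3))
    (c / e * (del p * q - 2 * p * del q)).
Proof.
move=> delD delM dlam dc e0 q0 on.
apply: diff_value_affine => //; first by rewrite mulf_neq0 ?invr_neq0 ?expf_neq0.
rewrite (derivation_div delM) ?expf_neq0 // !delM dc.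
by field; rewrite q0.
Qed.

(** * Curve equations for the three shapes of points *)

Section TwistPoints.

Variables (K : fieldType) (l A N D p q : K).
Hypotheses (two0 : 2 != 0 :> K) (l0 : l != 0) (D0 : D != 0) (q0 : q != 0).

Lemma on_twist_quotient1 :
  on_twist l (2 * N * (N - 2 * D ^+ 2) * (N - 2 * l * D ^+ 2))
    (Affine (N / (2 * D ^+ 2)) (1 / (4 * D ^+ 3))).
Proof.
have four0 : 4 != 0 :> K by rewrite (_ : 4 = 2 * 2) ?mulf_neq0 // -natrM.
by rewrite /=; field; rewrite D0 two0 four0.
Qed.

Hypothesis lA : l = - (2 * A ^+ 2).

(** The cubic at x = l^2 p / q^2 is -l^3 p (l^2 p - q^2) (q^2 - l p) / q^6. The assumption l = -2
    A^2 turns -l^3 into 2 (A l)^2, twice a square. *)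
Lemma on_twist_quotient2 :
  on_twist l (2 * p * (l ^+ 2 * p - q ^+ 2) * (q ^+ 2 - l * p))
    (Affine (l ^+ 2 * p / q ^+ 2) (A * l / q ^+ 3)).
Proof. by rewrite /= lA; field; rewrite q0. Qed.

(** Likewise with the constant -1 / l^3 = 2 (A / l^2)^2. *)
Lemma on_twist_quotient3 :
  on_twist l (2 * p * (l * q ^+ 2 - p) * (p - l ^+ 2 * q ^+ 2))
    (Affine (l^-1 * p / q ^+ 2) (- (A / l ^+ 2) / q ^+ 3)).
Proof.
by move: l0; rewrite /= lA => l0'; field; rewrite q0 l0'.
Qed.

End TwistPoints.

(* [q^3 (p / q^2)'] *)
Definition wronskian (F : fieldType) (p q : {poly F}) : {poly F} :=
  p^`() * q - 2 * p * q^`().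

(** The two terms 4 p4 q2 of degree 5 cancel, which leaves five coefficients. *)
Lemma Poly_wronskian (F : fieldType) (p0 p1 p2 p3 p4 q0 q1 q2 : F) :
  wronskian (Poly [:: p0; p1; p2; p3; p4]) (Poly [:: q0; q1; q2]) =
  Poly [:: p1 * q0 - 2 * p0 * q1;
           2 * p2 * q0 - p1 * q1 - 4 * p0 * q2;
           3 * p3 * q0 - 3 * p1 * q2;
           4 * p4 * q0 + p3 * q1 - 2 * p2 * q2;
           2 * p4 * q1 - p3 * q2].
Proof.
by rewrite /wronskian /= !cons_poly_def !derivE /=; ring.
Qed.

(** * Constants of Q(u) *)

Lemma ratcV c : ratc c^-1 = (ratc c)^-1.
Proof. exact: (fmorphV (@tofrac {poly rat} \o @polyC rat)). Qed.

Lemma ratcM c c' : ratc (c * c') = ratc c * ratc c'.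
Proof. by rewrite /ratc polyCM tofracM. Qed.

Lemma ratcN c : ratc (- c) = - ratc c.
Proof. by rewrite /ratc polyCN tofracN. Qed.

Lemma ratcX c n : ratc (c ^+ n) = ratc c ^+ n.
Proof. by rewrite /ratc polyC_exp tofracXn. Qed.

Lemma ratc_eq0 c : (ratc c == 0) = (c == 0).
Proof. by rewrite /ratc tofrac_eq0 polyC_eq0. Qed.

Lemma ratfun2_neq0 : 2 != 0 :> ratfun.
Proof.
have -> : 2 = ratc 2 by rewrite /ratc !rmorph_nat.
by rewrite ratc_eq0.
Qed.

(** * Linear independence of the polynomials V1, V2, V3 *)

Section Numerators.

Variables (F : realFieldType) (lam : F).
Let d0 := 2 - lam.
Let d2 := lam * (2 * lam - 1).

(** These are D and the quadratics q of [P2] and [P3], given by coefficients so that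
    [Poly_wronskian] applies. *)
Definition denom1 : {poly F} := Poly [:: d0; 0; d2].
Definition denom2 : {poly F} := Poly [:: - d0; - (2 * d2); d2].
Definition denom3 : {poly F} := Poly [:: - d0; 2 * d0; d2].

Definition numer1 : {poly F} :=
  Poly [:: (lam - 2) ^+ 2 * (lam + 1);
           - (4 * lam * (lam - 1) * (lam - 2));
           2 * lam * (lam + 1) * (2 * lam ^+ 2 - 3 * lam + 2);
           - (4 * lam ^+ 2 * (lam - 1) * (2 * lam - 1));
           lam ^+ 2 * (lam + 1) * (2 * lam - 1) ^+ 2].

(** [numer2] and [numer3] expand D^2 - h and D^2 + h, where h = 4 lam u (u - 1) (d2 u + d0). *)
Definition numer2 : {poly F} :=
  Poly [:: d0 ^+ 2; 4 * lam * d0; 2 * d0 * d2 - 4 * lam * (d0 - d2);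
           - (4 * lam * d2); d2 ^+ 2].

Definition numer3 : {poly F} :=
  Poly [:: d0 ^+ 2; - (4 * lam * d0); 2 * d0 * d2 + 4 * lam * (d0 - d2);
           4 * lam * d2; d2 ^+ 2].

Hypotheses (lam0 : lam != 0) (lam1 : lam != 1) (lamN1 : lam != -1).
Hypotheses (lam2 : lam != 2) (lamV2 : 2 * lam - 1 != 0).

Let d0_neq0 : d0 != 0. Proof. by rewrite subr_eq0 eq_sym. Qed.
Let d2_neq0 : d2 != 0. Proof. by rewrite mulf_neq0. Qed.

Lemma size_numer1 : size numer1 = 5%N.
Proof.
by rewrite (@PolyK _ 0) //= !mulf_neq0 ?expf_neq0 // addr_eq0.
Qed.

Lemma size_numer2 : size numer2 = 5%N.
Proof. by rewrite (@PolyK _ 0) //= expf_neq0. Qed.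

Lemma size_numer3 : size numer3 = 5%N.
Proof. by rewrite (@PolyK _ 0) //= expf_neq0. Qed.

Lemma denom1_neq0 : denom1 != 0.
Proof. by rewrite -size_poly_eq0 (@PolyK _ 0). Qed.

Lemma denom2_neq0 : denom2 != 0.
Proof. by rewrite -size_poly_eq0 (@PolyK _ 0). Qed.

Lemma denom3_neq0 : denom3 != 0.
Proof. by rewrite -size_poly_eq0 (@PolyK _ 0). Qed.

Lemma wronskians_free (k1 k2 k3 : F) :
    k1 *: wronskian numer1 denom1
    + k2 *: wronskian numer2 denom2
    + k3 *: wronskian numer3 denom3 = 0 ->
  [/\ k1 = 0, k2 = 0 & k3 = 0].
Proof.
rewrite !Poly_wronskian => e.
have E i := congr1 (fun p : {poly F} => p`_i) e.
have := E 0; have := E 2; have := E 3; move=> {E e}.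
rewrite !coefD !coefZ !coef_Poly !coef0 /= /d0 /d2 => e3 e2 e0.
have l1 : lam - 1 != 0 by rewrite subr_eq0.
have l2 : lam - 2 != 0 by rewrite subr_eq0.
(* Coefficient of u^2, to which V2 and V3 contribute nothing. *)
have k1_0 : k1 = 0.
  apply: (mulIf (x := 24 * lam ^+ 2 * (lam - 1) * (2 * lam - 1) * (lam - 2))).
    by rewrite !mulf_neq0 ?expf_neq0 ?pnatr_eq0.
  by rewrite mul0r; apply: (etrans _ e2); ring.
(* The constant coefficient is 8 (lam - 1) (lam - 2)^2 (lam k2 + k3). *)
have k3_0 : k3 = - (lam * k2).
  apply/eqP; rewrite -subr_eq0; apply/eqP.
  apply: (mulIf (x := 8 * (lam - 1) * (lam - 2) ^+ 2)).
    by rewrite !mulf_neq0 ?expf_neq0 ?pnatr_eq0.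
  rewrite mul0r; apply: (etrans _ e0); rewrite k1_0; ring.
(* Coefficient of u^3 after eliminating k1 and k3. Its last factor is (lam - 1/2)^2 + 3/4, positive
   in an ordered field. *)
have k2_0 : k2 = 0.
  apply: (mulIf (x := - 32 * lam ^+ 2 * (lam - 1) * (2 * lam - 1) * (lam ^+ 2 - lam + 1))).
    rewrite !mulf_neq0 ?expf_neq0 ?oppr_eq0 ?pnatr_eq0 //.
    rewrite (_ : _ + 1 = (lam - 2^-1) ^+ 2 + 3 / 4); last by field.
    by rewrite gt_eqF // ltr_wpDl ?sqr_ge0 ?divr_gt0 ?ltr0n.
  rewrite mul0r; apply: (etrans _ e3); rewrite k1_0 k3_0; ring.
by rewrite k3_0 k2_0 mulr0 oppr0.
Qed.

End Numerators.

(** * Factorizations of g and the three points on its twist *)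

Section Specialization.

Variable lam : rat.
Local Notation numer1 := (numer1 lam).
Local Notation numer2 := (numer2 lam).
Local Notation numer3 := (numer3 lam).
Local Notation denom1 := (denom1 lam).
Local Notation denom2 := (denom2 lam).
Local Notation denom3 := (denom3 lam).

Lemma polyD_Poly : polyD lam = denom1.
Proof. by rewrite /polyD /denom1 /= !cons_poly_def; ring. Qed.

Lemma polyN_Poly : polyN lam = numer1.
Proof. by rewrite /polyN /numer1 /= !cons_poly_def; ring. Qed.

(** Up to a constant, g is the product of the quartics N, [numer2] and [numer3]. At each of the
    three points these are, in some order and up to constants, the numerators of x, x - 1 and x -
    lam. *)
Lemma numer2_polyN : polyN lam - 2 * polyD lam ^+ 2 = (lam - 1)%:P * numer2.
Proof. by rewrite /polyN /polyD /numer2 /= !cons_poly_def; ring. Qed.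

Lemma numer3_polyN :
  polyN lam - 2 * lam%:P * polyD lam ^+ 2 = (1 - lam)%:P * numer3.
Proof. by rewrite /polyN /polyD /numer3 /= !cons_poly_def; ring. Qed.

Lemma polyg_numer2 :
  polyg lam = 2 * numer2 * (lam%:P ^+ 2 * numer2 - denom2 ^+ 2)
              * (denom2 ^+ 2 - lam%:P * numer2).
Proof.
have eN : (lam - 1)%:P * polyN lam = lam%:P ^+ 2 * numer2 - denom2 ^+ 2.
  rewrite /polyN /numer2 /denom2 /= !cons_poly_def; ring.
have e3 : (1 - lam)%:P * numer3 = denom2 ^+ 2 - lam%:P * numer2.
  rewrite /numer3 /numer2 /denom2 /= !cons_poly_def; ring.
by rewrite /polyg numer2_polyN numer3_polyN -eN -e3; ring.
Qed.

Lemma polyg_numer3 :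
  polyg lam = 2 * numer3 * (lam%:P * denom3 ^+ 2 - numer3)
              * (numer3 - lam%:P ^+ 2 * denom3 ^+ 2).
Proof.
have eN : (1 - lam)%:P * polyN lam = numer3 - lam%:P ^+ 2 * denom3 ^+ 2.
  rewrite /polyN /numer3 /denom3 /= !cons_poly_def; ring.
have e2 : (lam - 1)%:P * numer2 = lam%:P * denom3 ^+ 2 - numer3.
  rewrite /numer3 /numer2 /denom3 /= !cons_poly_def; ring.
by rewrite /polyg numer2_polyN numer3_polyN -eN -e2; ring.
Qed.

Lemma P1_quotient :
  P1 lam = Affine (ratc 2^-1 * tofrac numer1 / tofrac denom1 ^+ 2)
                  (ratc 4^-1 / tofrac denom1 ^+ 3).
Proof.
rewrite /P1 polyD_Poly polyN_Poly !ratcV.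
have -> : ratc 2 = 2 by rewrite /ratc !rmorph_nat.
have -> : ratc 4 = 4 by rewrite /ratc !rmorph_nat.
by rewrite !invfM; congr Affine; rewrite ?mul1r // mulrCA mulrA.
Qed.

Lemma P2_quotient a :
  P2 a lam = Affine (ratc (lam ^+ 2) * tofrac numer2 / tofrac denom2 ^+ 2)
                  (ratc (a * lam) / tofrac denom2 ^+ 3).
Proof.
rewrite /P2.
have -> : ratc lam * (2 * ratc lam - 1) * uvar ^+ 2 -
   2 * ratc lam * (2 * ratc lam - 1) * uvar + ratc lam - 2 = tofrac denom2.
  by rewrite /denom2 /ratc /uvar /= !cons_poly_def; ring.
congr (Affine (_ / _) (_ / _)).
  rewrite /numer2 /polyD /ratc /uvar /= !cons_poly_def; ring.
rewrite /ratc; ring.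
Qed.

Lemma P3_quotient a :
  P3 a lam = Affine (ratc lam^-1 * tofrac numer3 / tofrac denom3 ^+ 2)
                  (ratc (- (a / lam ^+ 2)) / tofrac denom3 ^+ 3).
Proof.
rewrite /P3.
have -> : ratc lam * (2 * ratc lam - 1) * uvar ^+ 2 -
   (2 * ratc lam - 4) * uvar + ratc lam - 2 = tofrac denom3.
  by rewrite /denom3 /ratc /uvar /= !cons_poly_def; ring.
rewrite ratcN ratcM !ratcV ratcX; congr Affine.
  rewrite invfM [LHS]mulrCA mulrA; congr (_ * _ / _).
  rewrite /numer3 /polyD /ratc /uvar /= !cons_poly_def; ring.
by rewrite [in LHS]invfM mulrA mulNr.
Qed.

Hypotheses (lam0 : lam != 0) (lam1 : lam != 1) (lamN1 : lam != -1).
Hypotheses (lam2 : lam != 2) (lamV2 : 2 * lam - 1 != 0).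

Lemma size_polyg : size (polyg lam) = 13%N.
Proof.
rewrite /polyg numer2_polyN numer3_polyN polyN_Poly.
have -> : 2 * numer1 * ((lam - 1)%:P * numer2) * ((1 - lam)%:P * numer3)
  = (2 * (lam - 1) * (1 - lam))%:P * (numer1 * (numer2 * numer3)) by ring.
have nz (p : {poly rat}) : size p = 5%N -> p != 0 by rewrite -size_poly_eq0 => ->.
rewrite size_Cmul ?mulf_neq0 ?subr_eq0 1?[1 == _]eq_sym //.
by rewrite !size_mul ?mulf_neq0 ?nz ?size_numer1 ?size_numer2 ?size_numer3.
Qed.

Lemma polyg_tofrac :
  tofrac (polyg lam) = 2 * tofrac (polyN lam)
    * (tofrac (polyN lam) - 2 * tofrac (polyD lam) ^+ 2)
    * (tofrac (polyN lam) - 2 * ratc lam * tofrac (polyD lam) ^+ 2).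
Proof. by rewrite /polyg !(tofracM, tofracB, tofracXn) (rmorph_nat _ 2). Qed.

Lemma on_twist_P1 : on_twist (ratc lam) (tofrac (polyg lam)) (P1 lam).
Proof.
rewrite polyg_tofrac; apply: on_twist_quotient1; first exact: ratfun2_neq0.
by rewrite tofrac_eq0 polyD_Poly denom1_neq0.
Qed.

Lemma ratc_lam a : lam = - (2 * a ^+ 2) -> ratc lam = - (2 * ratc a ^+ 2).
Proof. by move=> ->; rewrite /ratc; ring. Qed.

Lemma on_twist_P2 a : lam = - (2 * a ^+ 2) ->
  on_twist (ratc lam) (tofrac (polyg lam)) (P2 a lam).
Proof.
move=> hlam; rewrite P2_quotient polyg_numer2 ratcM ratcX.
rewrite !(tofracM, tofracB, tofracXn) (rmorph_nat _ 2).
apply: on_twist_quotient2; last exact: ratc_lam.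
by rewrite tofrac_eq0 denom2_neq0.
Qed.

Lemma on_twist_P3 a : lam = - (2 * a ^+ 2) ->
  on_twist (ratc lam) (tofrac (polyg lam)) (P3 a lam).
Proof.
move=> hlam; rewrite P3_quotient polyg_numer3 ratcN ratcM !ratcV ratcX.
rewrite !(tofracM, tofracB, tofracXn) (rmorph_nat _ 2).
apply: on_twist_quotient3; last exact: ratc_lam.
- by rewrite ratc_eq0.
- by rewrite tofrac_eq0 denom3_neq0.
Qed.

End Specialization.

(** * Differentiation on Q(u) *)

Definition ratderiv : ratfun -> ratfun :=
  quoderiv (@tofrac {poly rat}) (@fracnum _) (@fracden _) (@deriv rat).

Lemma ratderivD x y : ratderiv (x + y) = ratderiv x + ratderiv y.
Proof.
apply: quoderivD; [exact: tofrac_inj | exact: fracden_neq0 | exact: fracnumden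
  | exact: derivD | exact: derivM].
Qed.

Lemma ratderivM x y : ratderiv (x * y) = ratderiv x * y + x * ratderiv y.
Proof.
apply: quoderivM; [exact: tofrac_inj | exact: fracden_neq0 | exact: fracnumden
  | exact: derivM].
Qed.

Lemma ratderiv_tofrac p : ratderiv (tofrac p) = tofrac p^`().
Proof.
apply: quoderiv_embed; [exact: tofrac_inj | exact: fracden_neq0
  | exact: fracnumden | exact: derivM].
Qed.

Lemma ratderiv_ratc c : ratderiv (ratc c) = 0.
Proof. by rewrite ratderiv_tofrac derivC tofrac0. Qed.

(** The value is the image of a polynomial, which reduces independence of the points to linear
    algebra over Q on coefficients. *)
Lemma ratfun_diff_value (P : point ratfun) (lam c e : rat) (d : ratfun)
    (p q : {poly rat}) :
    e != 0 -> q != 0 ->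
    P = Affine (ratc c * tofrac p / tofrac q ^+ 2) (ratc e / tofrac q ^+ 3) ->
    on_twist (ratc lam) d P ->
  diff_value ratderiv (ratc lam) d P (tofrac ((c / e) *: wronskian p q)).
Proof.
move=> e0 q0 -> on.
rewrite /wronskian -mul_polyC !(tofracM, tofracB) (rmorph_nat _ 2) -!ratderiv_tofrac.
rewrite -/(ratc _) ratcM ratcV; apply: diff_value_cube => //.
- exact: ratderivD.
- exact: ratderivM.
- exact: ratderiv_ratc.
- exact: ratderiv_ratc.
- by rewrite ratc_eq0.
- by rewrite tofrac_eq0.
Qed.

(** In n^2 = 2 d^2 the 2-adic valuation is even on the left and odd on the right. *)
Lemma rat_sqr_neq2 (x : rat) : x ^+ 2 != 2.
Proof.
apply/eqP => e; have d0 := denq_neq0 x.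
have {e} : (numq x ^+ 2 = 2 * denq x ^+ 2)%R.
  apply: (@intr_inj rat).
  by rewrite [LHS]rmorphXn [RHS]rmorphM [X in _ = _ * X]rmorphXn /= numqE exprMn e.
move/(congr1 absz); rewrite abszM !abszX => e.
have n0 : (0 < `|denq x|)%N by rewrite absz_gt0.
have := congr1 (logn 2) e.
rewrite lognM ?expn_gt0 ?n0 // !lognX => /(congr1 odd).
by rewrite oddD !oddM.
Qed.

Lemma mulrz_eq0_int (R : numDomainType) (x : R) (n : int) :
  x != 0 -> x *~ n = 0 -> n = 0.
Proof. by move=> x0 /eqP; rewrite mulrz_eq0 (negPf x0) orbF => /eqP. Qed.

(** The indices have the form that [big_ord_recl] produces. *)
Lemma forall_ord3 (T : Type) (f : 'I_3 -> T) (y : T) :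
    f ord0 = y -> f (lift ord0 ord0) = y -> f (lift ord0 (lift ord0 ord0)) = y ->
  forall i, f i = y.
Proof.
move=> y0 y1 y2 [[|[|[|]]] //= lt_i3].
- by rewrite -y0; congr f; apply: val_inj.
- by rewrite -y1; congr f; apply: val_inj.
- by rewrite -y2; congr f; apply: val_inj.
Qed.

Theorem theorem4p1 (a lam : rat) (ha : a != 0) (hlam : lam = - (2 * a ^+ 2)) :
  size (polyg lam) = 13%N /\
  twist_rank_ge (ratc lam) (tofrac (polyg lam)) 3 /\
  twist_independent (ratc lam) (tofrac (polyg lam)) [tuple P1 lam; P2 a lam; P3 a lam].
Proof.
have lam_lt0 : lam < 0.
  by rewrite hlam oppr_lt0 mulr_gt0 // lt0r sqrf_eq0 ha sqr_ge0.
have lam0 : lam != 0 by rewrite lt_eqF.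
have lam1 : lam != 1 by rewrite lt_eqF // (lt_trans lam_lt0).
have lam2 : lam != 2 by rewrite lt_eqF // (lt_trans lam_lt0).
have lamV2 : 2 * lam - 1 != 0 by rewrite lt_eqF // subr_lt0; lra.
(* The leading coefficient of N has the factor lam + 1, so the degree of g depends on this. If lam =
   -1 then (2 a)^2 = 2. *)
have lamN1 : lam != -1.
  apply: contraNneq (rat_sqr_neq2 (2 * a)) => h; apply/eqP.
  have -> : (2 * a) ^+ 2 = 2 * (2 * a ^+ 2) by ring.
  by rewrite -[2 * a ^+ 2]opprK -hlam h opprK mulr1.
have size_g := size_polyg lam0 lam1 lamN1 lamV2.
suff indep : twist_independent (ratc lam) (tofrac (polyg lam))
    [tuple P1 lam; P2 a lam; P3 a lam].
  by split=> //; split=> //; exists [tuple P1 lam; P2 a lam; P3 a lam].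
have on1 := on_twist_P1 lam0 lamV2.
have on2 := on_twist_P2 lam0 lamV2 hlam.
have on3 := on_twist_P3 lam0 lamV2 hlam.
have d0 : tofrac (polyg lam) != 0 by rewrite tofrac_eq0 -size_poly_eq0 size_g.
(* Each scalar is the quotient c / e read off from [P1_quotient], [P2_quotient] and
   [P3_quotient]. *)
pose k1 : rat := 2^-1 / 4^-1.
pose k2 := lam ^+ 2 / (a * lam).
pose k3 := lam^-1 / - (a / lam ^+ 2).
have k1_neq0 : k1 != 0 by [].
have k2_neq0 : k2 != 0 by rewrite !(mulf_neq0, invr_neq0, expf_neq0).
have k3_neq0 : k3 != 0 by rewrite !(mulf_neq0, invr_neq0, oppr_eq0, expf_neq0).
pose w1 := tofrac (k1 *: wronskian (numer1 lam) (denom1 lam)).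
pose w2 := tofrac (k2 *: wronskian (numer2 lam) (denom2 lam)).
pose w3 := tofrac (k3 *: wronskian (numer3 lam) (denom3 lam)).
have v1 : diff_value ratderiv (ratc lam) (tofrac (polyg lam)) (P1 lam) w1.
  apply: (ratfun_diff_value _ _ (P1_quotient lam) on1).
  - by rewrite invr_eq0 pnatr_eq0.
  - exact: denom1_neq0.
have v2 : diff_value ratderiv (ratc lam) (tofrac (polyg lam)) (P2 a lam) w2.
  apply: (ratfun_diff_value _ _ (P2_quotient lam a) on2).
  - by rewrite mulf_neq0.
  - exact: denom2_neq0.
have v3 : diff_value ratderiv (ratc lam) (tofrac (polyg lam)) (P3 a lam) w3.
  apply: (ratfun_diff_value _ _ (P3_quotient lam a) on3).
  - rewrite oppr_eq0; apply: mulf_neq0; first exact: ha.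
    by rewrite invr_eq0 expf_eq0 (negPf lam0).
  - exact: denom3_neq0.
have l0 : ratc lam != 0 by rewrite ratc_eq0.
have l1 : ratc lam != 1.
  have e : ratc lam - 1 = ratc (lam - 1) by rewrite /ratc; ring.
  by rewrite -subr_eq0 e ratc_eq0 subr_eq0.
apply: (diff_value_independent ratderivD ratderivM ratfun2_neq0 d0 l0 l1
  (ratderiv_ratc lam) (w := fun i => tnth [tuple w1; w2; w3] i)).
- by case=> [[|[|[|]]]].
- by case=> [[|[|[|]]]].
move=> n; rewrite !big_ord_recl big_ord0 addr0 /= !(tnth_nth 0) /=.
rewrite /w1 /w2 /w3 -!(raddfMz (@tofrac {poly rat})) -!tofracD => /eqP.
rewrite tofrac_eq0 !scalerMzl addrA => /eqP.
(* The integers have been absorbed into the scalars, so this gives k1 *~ n 0 = 0 and its analogues;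
   the nonzero factors then cancel. *)
case/(wronskians_free lam0 lam1 lam2 lamV2).
move=> /(mulrz_eq0_int k1_neq0) n0 /(mulrz_eq0_int k2_neq0) n1.
move=> /(mulrz_eq0_int k3_neq0) n2.
exact: (forall_ord3 n0 n1 n2).
Qed.
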